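(* Let $X$ and $Y$ be two $(\varepsilon,r_0)$-Reifenberg-flat domains in $\mathbb{R}^N$. Then the following implications hold: (1) if $d_H(X,Y)\le 4r_0$, then $$d_H(X,Y)\le\frac{8}{1-2\varepsilon}\left(\frac{|X\triangle Y|}{\omega_N}\right)^{1/N};$$ (2) if $d_H(X^c,Y^c)\le 4r_0$, then $$d_H(X^c,Y^c)\le\frac{8}{1-2\varepsilon}\left(\frac{|X\triangle Y|}{\omega_N}\right)^{1/N}.$$
   Context: Notation: $A^c=\mathbb{R}^N\setminus A$; $|A|$ is the Lebesgue measure of $A$; $X\triangle Y$ is the symmetric difference; $\omega_N$ is the Lebesgue measure of the unit ball in $\mathbb{R}^N$; $B(x,r)$ is the open ball; $d(x,A)$ is the distance from a point to a set; the Hausdorff distance is $d_H(X,Y)=\max\{\sup_{x\in X}d(x,Y),\ \sup_{y\in Y}d(y,X)\}$ (with values in $[0,+\infty]$; conventions $d(x,\emptyset)=+\infty$ and supremum over the empty set equal to $0$). Reifenberg-flat domain: let $0<\varepsilon<1/2$ and $r_0>0$. An $(\varepsilon,r_0)$-Reifenberg-flat domain $\Omega\subseteq\mathbb{R}^N$ is a nonempty open set such that: (i) for every $x\in\partial\Omega$ and every $0<r\le r_0$ there is a (affine) hyperplane $P(x,r)$ containing $x$ with $\frac1r d_H\big(\partial\Omega\cap B(x,r),P(x,r)\cap B(x,r)\big)\le\varepsilon$; (ii) for every $x\in\partial\Omega$, one of the two connected components of $B(x,r_0)\cap\{y: d(y,P(x,r_0))\ge 2\varepsilon r_0\}$ is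 contained in $\Omega$ and the other one is contained in $\mathbb{R}^N\setminus\Omega$. *)

(* Defs.v *)
From HB Require Import structures.
From mathcomp Require Import all_boot all_order all_algebra.
From mathcomp Require Import all_classical all_reals all_analysis.
Set Implicit Arguments.
Unset Strict Implicit.
Unset Printing Implicit Defensive.
Import Order.TTheory GRing.Theory Num.Theory.
Import numFieldNormedType.Exports.
Local Open Scope classical_set_scope.
Local Open Scope ring_scope.

(* The library's norm and balls on 'rV[R]_N are those of the sup norm, so the
   Euclidean ones are defined here.  The topology of 'rV[R]_N (closure,
   interior, connectedness) is the usual one, for which the choice of norm is
   irrelevant. *)
Definition dotv (R : realType) (N : nat) (u v : 'rV[R]_N) : R :=
  \sum_(i < N) u 0 i * v 0 i.

Definition enorm (R : realType) (N : nat) (u : 'rV[R]_N) : R :=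
  Num.sqrt (dotv u u).

Definition eball (R : realType) (N : nat) (x : 'rV[R]_N) (r : R) :
  set 'rV[R]_N := [set y | enorm (y - x) < r].

(* The infimum over the empty set is +oo. *)
Definition dist_set (R : realType) (N : nat) (x : 'rV[R]_N)
  (A : set 'rV[R]_N) : \bar R :=
  ereal_inf [set (enorm (x - a))%:E | a in A].

(* ereal_sup set0 = -oo in the library; 0 is adjoined so that a supremum of
   distances over the empty set is 0. *)
Definition excess (R : realType) (N : nat) (A B : set 'rV[R]_N) : \bar R :=
  ereal_sup (0%E |` [set dist_set x B | x in A]).

Definition hausdorff_dist (R : realType) (N : nat) (A B : set 'rV[R]_N) :
  \bar R := maxe (excess A B) (excess B A).

Definition hyperplane (R : realType) (N : nat) (P : set 'rV[R]_N) : Prop :=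
  exists (n : 'rV[R]_N) (c : R), n != 0 /\ P = [set y | dotv n y = c].

Definition boundary (T : topologicalType) (A : set T) : set T :=
  closure A `\` interior A.

Definition components (T : topologicalType) (A : set T) : set (set T) :=
  [set connected_component A x | x in A].

(* P x r is the hyperplane chosen at x and scale r; the second condition uses
   the same choice at scale r0 as the first one. *)
Definition reifenberg_flat (R : realType) (N : nat) (eps r0 : R)
  (Om : set 'rV[R]_N) : Prop :=
  [/\ Om !=set0, open Om &
   exists P : 'rV[R]_N -> R -> set 'rV[R]_N,
    (forall x r, boundary Om x -> 0 < r -> r <= r0 ->
      [/\ hyperplane (P x r), P x r x &
       ((r^-1)%:E * hausdorff_dist (boundary Om `&` eball x r)
                                   (P x r `&` eball x r) <= eps%:E)%E]) /\
    (forall x, boundary Om x ->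
      exists C1 C2 : set 'rV[R]_N,
       [/\ C1 <> C2,
        components (eball x r0 `&`
            [set y | ((2 * eps * r0)%:E <= dist_set y (P x r0))%E])
          = [set C1; C2],
        C1 `<=` Om & C2 `<=` ~` Om])].

Definition box (R : realType) (N : nat) (a b : 'rV[R]_N) : set 'rV[R]_N :=
  [set x | forall i, a 0 i <= x 0 i <= b 0 i].

(* Lebesgue outer measure of R^N: the infimum of the total volumes of the
   countable covers by closed boxes.  On Lebesgue measurable sets, in particular
   on balls and on symmetric differences of open sets, it is by definition the
   Lebesgue measure. *)
Definition leb (R : realType) (N : nat) (A : set 'rV[R]_N) : \bar R :=
  ereal_inf [set v | exists a b : nat -> 'rV[R]_N,
    [/\ forall k i, a k 0 i <= b k 0 i,
        A `<=` \bigcup_k box (a k) (b k) &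
        v = (\sum_(0 <= k <oo) (\prod_(i < N) (b k 0 i - a k 0 i))%:E)%E]].

Definition omega (R : realType) (N : nat) : \bar R :=
  leb (eball (0 : 'rV[R]_N) 1).

(* Main.v *)
Require Import Defs.
From mathcomp Require Import all_boot all_order all_algebra.
From mathcomp Require Import all_classical all_reals all_analysis.
From mathcomp Require Import measurable_realfun ring lra.
Set Implicit Arguments.
Unset Strict Implicit.
Unset Printing Implicit Defensive.
Import numFieldNormedType.Exports.
Import Order.TTheory GRing.Theory Num.Theory.
Local Open Scope classical_set_scope.
Local Open Scope ring_scope.

(* Let x be a boundary point of a flat domain, r <= r0 and n a unit normal of
   P(x,r).  The two caps {|y - x| < r, +-n.(y - x) > eps r} are convex and miss
   the boundary, so each lies in the domain or in its complement.  At scale r0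
   condition (ii) puts them on different sides; going down in scale by factors
   4/3, each cap meets the corresponding cap of the larger scale, so this stays
   true for every r <= r0.  Hence both the domain and its complement contain a
   ball of radius (1 - 2 eps) r / 2 inside B(x,r).
   If x is in A (one of X, Y, or of their complements) and B is at distance
   d <= 4 r0 from x, then either B(x,d/2) lies in A, or it contains a boundary
   point w of A and the previous remark applies to B(w,d/4); in both cases a
   ball of radius (1 - 2 eps) d / 8 lies in A \ B.  It remains to compare
   volumes, which for the outer measure [leb] needs that the unit ball has
   positive finite measure. *)

(** * Euclidean inner product and norm *)

Lemma dotvC (R : realType) N (u v : 'rV[R]_N) : dotv u v = dotv v u.
Proof. by apply: eq_bigr => i _; rewrite mulrC. Qed.

Lemma dotvDl (R : realType) N (u v w : 'rV[R]_N) :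
  dotv (u + v) w = dotv u w + dotv v w.
Proof. by rewrite -big_split /=; apply: eq_bigr => i _; rewrite mxE mulrDl. Qed.

Lemma dotvZl (R : realType) N (a : R) (u w : 'rV[R]_N) :
  dotv (a *: u) w = a * dotv u w.
Proof. by rewrite mulr_sumr; apply: eq_bigr => i _; rewrite mxE mulrA. Qed.

Lemma dotvNl (R : realType) N (u w : 'rV[R]_N) : dotv (- u) w = - dotv u w.
Proof. by rewrite -scaleN1r dotvZl mulN1r. Qed.

Lemma dotvDr (R : realType) N (u v w : 'rV[R]_N) :
  dotv w (u + v) = dotv w u + dotv w v.
Proof. by rewrite !(dotvC w) dotvDl. Qed.

Lemma dotvZr (R : realType) N (a : R) (u w : 'rV[R]_N) :
  dotv w (a *: u) = a * dotv w u.
Proof. by rewrite !(dotvC w) dotvZl. Qed.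

Lemma dotvNr (R : realType) N (u w : 'rV[R]_N) : dotv w (- u) = - dotv w u.
Proof. by rewrite !(dotvC w) dotvNl. Qed.

Definition dotvE := (dotvDl, dotvDr, dotvNl, dotvNr, dotvZl, dotvZr).

Lemma dotv_ge0 (R : realType) N (u : 'rV[R]_N) : 0 <= dotv u u.
Proof. by apply: sumr_ge0 => i _; rewrite -expr2 sqr_ge0. Qed.

Lemma dotv_eq0 (R : realType) N (u : 'rV[R]_N) : dotv u u = 0 -> u = 0.
Proof.
move=> /eqP; rewrite psumr_eq0 => [/allP u0|i _]; last by rewrite -expr2 sqr_ge0.
apply/rowP => i; rewrite mxE; apply/eqP.
by have := u0 i (mem_index_enum i); rewrite implyTb -expr2 sqrf_eq0.
Qed.

Lemma enorm_ge0 (R : realType) N (u : 'rV[R]_N) : 0 <= enorm u.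
Proof. exact: sqrtr_ge0. Qed.

Lemma sqr_enorm (R : realType) N (u : 'rV[R]_N) : enorm u ^+ 2 = dotv u u.
Proof. exact/sqr_sqrtr/dotv_ge0. Qed.

Lemma enorm0 (R : realType) N : enorm (0 : 'rV[R]_N) = 0.
Proof. by rewrite /enorm -(scale0r 0) dotvZl mul0r sqrtr0. Qed.

Lemma enormZ (R : realType) N (a : R) (u : 'rV[R]_N) :
  enorm (a *: u) = `|a| * enorm u.
Proof. by rewrite /enorm !dotvE mulrA -expr2 sqrtrM ?sqr_ge0// sqrtr_sqr. Qed.

Lemma enormN (R : realType) N (u : 'rV[R]_N) : enorm (- u) = enorm u.
Proof. by rewrite /enorm !dotvE opprK. Qed.

Lemma enormBC (R : realType) N (u v : 'rV[R]_N) : enorm (u - v) = enorm (v - u).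
Proof. by rewrite -enormN opprB. Qed.

(** Cauchy-Schwarz: the squared norm of [(v.v) u - (u.v) v] is [v.v] times the difference of the two
    sides. *)
Lemma sqr_dotv_le (R : realType) N (u v : 'rV[R]_N) :
  dotv u v ^+ 2 <= dotv u u * dotv v v.
Proof.
have [v0|v0] := eqVneq (dotv v v) 0.
  by rewrite (dotv_eq0 v0) -(scale0r 0) !dotvE !mul0r mulr0 expr2 mul0r.
have vgt0 : 0 < dotv v v by rewrite lt_def v0 dotv_ge0.
have := dotv_ge0 (dotv v v *: u - dotv u v *: v).
rewrite !dotvE (dotvC v u) => h.
rewrite -subr_ge0 -(pmulr_rge0 _ vgt0).
by apply: le_trans h _; rewrite le_eqVlt; apply/orP; left; apply/eqP; ring.
Qed.

Lemma dotv_le_enorm (R : realType) N (u v : 'rV[R]_N) :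
  `|dotv u v| <= enorm u * enorm v.
Proof.
rewrite -sqrtr_sqr /enorm -sqrtrM ?dotv_ge0//.
by rewrite ler_wsqrtr// sqr_dotv_le.
Qed.

Lemma dotv_unit_le (R : realType) N (n u : 'rV[R]_N) :
  dotv n n = 1 -> `|dotv n u| <= enorm u.
Proof.
by move=> n1; have := dotv_le_enorm n u; rewrite [enorm n]/enorm n1 sqrtr1 mul1r.
Qed.

Lemma enormD (R : realType) N (u v : 'rV[R]_N) :
  enorm (u + v) <= enorm u + enorm v.
Proof.
rewrite -(@ler_pXn2r _ 2) ?nnegrE ?addr_ge0 ?enorm_ge0//.
rewrite sqrrD !sqr_enorm !dotvE (dotvC v u).
have := le_trans (ler_norm _) (dotv_le_enorm u v).
by move=> h; lra.
Qed.

Lemma enorm_dist (R : realType) N (x y z : 'rV[R]_N) :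
  enorm (x - z) <= enorm (x - y) + enorm (y - z).
Proof. by rewrite (le_trans _ (enormD _ _))// addrA subrK. Qed.

Lemma enorm_lt (R : realType) N (u : 'rV[R]_N) (r : R) :
  0 < r -> (enorm u < r) = (dotv u u < r ^+ 2).
Proof.
move=> r0; rewrite -sqr_enorm ltr_pXn2r ?nnegrE ?enorm_ge0//; exact: ltW.
Qed.

Lemma dist_set_ge (R : realType) N (x : 'rV[R]_N) A (c : R) :
  (c%:E <= dist_set x A)%E <-> forall a, A a -> c <= enorm (x - a).
Proof.
split=> [h a Aa|h].
  by rewrite -lee_fin (le_trans h)//; apply: ereal_inf_lbound; exists a.
by apply/ereal_infP => _ [a Aa <-]; rewrite lee_fin h.
Qed.

(** * Segments and boundary crossing *)

Definition segment (R : realType) N (y z : 'rV[R]_N) : set 'rV[R]_N :=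
  [set y + t *: (z - y) | t in `[0, 1]].

Lemma segment_start (R : realType) N (y z : 'rV[R]_N) : segment y z y.
Proof. by exists 0; rewrite ?scale0r ?addr0//= in_itv /= lexx ler01. Qed.

Lemma segment_end (R : realType) N (y z : 'rV[R]_N) : segment y z z.
Proof. by exists 1; rewrite ?scale1r ?subrKC//= in_itv /= lexx ler01. Qed.

Lemma connected_segment (R : realType) N (y z : 'rV[R]_N) :
  connected (segment y z).
Proof.
apply: connected_continuous_connected; first exact: segment_connected.
apply: continuous_subspaceT => t.
apply: cvgD; first exact: cvg_cst.
exact: scalel_continuous.
Qed.

(** A segment free of boundary points meets [Om] and [closure Om] in the same set, which is thus
    open and closed in the connected segment. *)
Lemma segment_avoiding_boundary (R : realType) N (Om : set 'rV[R]_N) y z :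
  open Om -> (forall w, segment y z w -> ~ boundary Om w) -> Om y -> Om z.
Proof.
move=> oOm nb Oy.
suff e : segment y z `&` Om = segment y z.
  by have := segment_end y z; rewrite -e => -[].
apply: connected_segment.
- by exists y; split => //; exact: segment_start.
- by exists Om.
- exists (closure Om); first exact: closed_closure.
  apply/seteqP; split=> w [sw Ow]; split => //; first exact: subset_closure.
  apply: contrapT => nOw; apply: (nb w sw); split => //.
  by move/interior_subset.
Qed.

Lemma segment_boundary_point (R : realType) N (Om : set 'rV[R]_N) y z :
  open Om -> Om y -> ~ Om z -> exists2 w, segment y z w & boundary Om w.
Proof.
move=> oOm Oy nOz; apply: contrapT => h; apply: nOz.
by apply: segment_avoiding_boundary Oy => // w sw bw; apply: h; exists w.
Qed.

Lemma segment_closed_halfspace (R : realType) N (n x y z w : 'rV[R]_N) (c : R) :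
  c <= dotv n (y - x) -> c <= dotv n (z - x) -> segment y z w ->
  c <= dotv n (w - x).
Proof.
rewrite -!(subr_ge0 c) => hy hz [t /=]; rewrite in_itv /= => /andP[t0 t1] <-.
have t1' : 0 <= 1 - t by rewrite subr_ge0.
by have := addr_ge0 (mulr_ge0 t0 hz) (mulr_ge0 t1' hy); rewrite !dotvE; lra.
Qed.

Lemma segment_halfspace (R : realType) N (n x y z w : 'rV[R]_N) (c : R) :
  c < dotv n (y - x) -> c < dotv n (z - x) -> segment y z w ->
  c < dotv n (w - x).
Proof.
move=> hy hz sw.
(* The smaller endpoint value serves as the level of a closed half-space. *)
have hc : c < Num.min (dotv n (y - x)) (dotv n (z - x)) by rewrite lt_min hy.
apply: lt_le_trans hc _.
by apply: segment_closed_halfspace sw; rewrite ge_min lexx ?orbT.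
Qed.

Lemma segment_eball (R : realType) N (x y z w : 'rV[R]_N) (r : R) :
  eball x r y -> eball x r z -> segment y z w -> eball x r w.
Proof.
rewrite /eball /= => hy hz [t /=]; rewrite in_itv /= => /andP[t0 t1] <-.
have -> : y + t *: (z - y) - x = (1 - t) *: (y - x) + t *: (z - x).
  by apply/rowP => i; rewrite !mxE; ring.
apply: le_lt_trans (enormD _ _) _.
rewrite !enormZ !ger0_norm ?subr_ge0//.
set m := Num.max (enorm (y - x)) (enorm (z - x)).
have hm : m < r by rewrite gt_max hy.
apply: le_lt_trans hm.
have -> : m = (1 - t) * m + t * m by ring.
by apply: lerD; rewrite ler_wpM2l ?subr_ge0// le_max lexx ?orbT.
Qed.

Lemma boundary_near (R : realType) N (Om : set 'rV[R]_N) x y z r :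
  open Om -> eball x r y -> eball x r z -> Om y -> ~ Om z ->
  exists2 w, boundary Om w & eball x r w.
Proof.
move=> oOm xy xz Oy nOz.
have [w sw bw] := segment_boundary_point oOm Oy nOz.
by exists w => //; apply: segment_eball sw.
Qed.

(** * Distance to hyperplanes and the strip around the boundary *)

Lemma hyperplane_unit_normal (R : realType) N (P : set 'rV[R]_N) x :
  hyperplane P -> P x ->
  exists2 n, dotv n n = 1 & P = [set y | dotv n (y - x) = 0].
Proof.
move=> [m [c [m0 ->]]] /= mx.
have e0 : enorm m != 0.
  apply: contra m0 => /eqP e; apply/eqP/dotv_eq0.
  by rewrite -sqr_enorm e expr0n.
exists ((enorm m)^-1 *: m).
  by rewrite !dotvE -sqr_enorm expr2 mulKf// mulVf.
apply/seteqP; split=> y /=; rewrite !dotvE mx -mulrBr.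
  by move=> ->; rewrite subrr mulr0.
by move/eqP; rewrite mulf_eq0 invr_eq0 (negbTE e0) /= subr_eq0 => /eqP.
Qed.

(** The orthogonal projection of [y] attains the distance; Cauchy-Schwarz gives the lower bound. *)
Lemma dist_hyperplane (R : realType) N (n x y : 'rV[R]_N) :
  dotv n n = 1 ->
  dist_set y [set z | dotv n (z - x) = 0] = `|dotv n (y - x)|%:E.
Proof.
move=> n1; apply/le_anti/andP; split.
  apply: ereal_inf_lbound; exists (y - dotv n (y - x) *: n) => /=.
    by rewrite !dotvE n1; ring.
  by rewrite opprB addrC subrK enormZ [enorm n]/enorm n1 sqrtr1 mulr1.
apply/dist_set_ge => z /= nz.
have -> : dotv n (y - x) = dotv n (y - z) by move: nz; rewrite !dotvE; lra.
exact: dotv_unit_le.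
Qed.

Lemma dist_le_hausdorff (R : realType) N (A B : set 'rV[R]_N) z :
  A z -> (dist_set z B <= hausdorff_dist A B)%E.
Proof.
move=> Az; rewrite /hausdorff_dist le_max; apply/orP; left.
by apply: ereal_sup_ubound; right; exists z.
Qed.

Lemma dist_set_subset (R : realType) N (A B : set 'rV[R]_N) z :
  A `<=` B -> (dist_set z B <= dist_set z A)%E.
Proof. by move=> AB; apply/ereal_inf_le_tmp/image_subset. Qed.

(** The distance from a point of [A] to the whole plane is at most the distance to its trace in the
    ball, hence at most the Hausdorff distance. *)
Lemma flat_strip (R : realType) N (eps r : R) (A P : set 'rV[R]_N) x :
  0 < r -> hyperplane P -> P x ->
  ((r^-1)%:E * hausdorff_dist A (P `&` eball x r) <= eps%:E)%E ->
  exists n, [/\ dotv n n = 1, P = [set y | dotv n (y - x) = 0] &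
    forall z, A z -> `|dotv n (z - x)| <= eps * r].
Proof.
move=> r0 hP Px; rewrite lee_pdivrMl// => hd.
have [n n1 defP] := hyperplane_unit_normal hP Px.
exists n; split=> // z Az; rewrite -lee_fin -(dist_hyperplane _ _ n1) -defP.
rewrite (mulrC eps) EFinM; apply: le_trans hd.
apply: le_trans (dist_le_hausdorff _ Az).
by apply: dist_set_subset => ? [].
Qed.

(** * Caps on the two sides of the strip, at all scales *)

Definition cap (R : realType) N (x n : 'rV[R]_N) (eps r : R) : set 'rV[R]_N :=
  [set y | enorm (y - x) < r /\ eps * r < dotv n (y - x)].

(** The cap is convex and lies beyond the strip, so a segment joining two of its points never
    crosses the boundary. *)
Lemma cap_homogeneous (R : realType) N (Om : set 'rV[R]_N) x n eps r y :
  open Om ->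
  (forall z, boundary Om z -> eball x r z -> `|dotv n (z - x)| <= eps * r) ->
  cap x n eps r y ->
  (Om y -> cap x n eps r `<=` Om) /\ (~ Om y -> cap x n eps r `<=` ~` Om).
Proof.
move=> oOm strip [yr ny].
have nb z w : cap x n eps r z -> segment y z w -> boundary Om w -> False.
  move=> [zr nz] sw bw; have := strip w bw (segment_eball yr zr sw).
  rewrite leNgt (lt_le_trans (segment_halfspace ny nz sw))//.
  exact: ler_norm.
split=> Oy z cz.
  by apply: (segment_avoiding_boundary oOm _ Oy) => w sw; exact: nb sw.
move=> Oz; have [w sw bw] := segment_boundary_point oOm Oz Oy.
(* The crossing was found on the segment from [z], the end inside [Om]; it is reparametrized from
   [y]. *)
have {}sw : segment y z w.
  case: sw => t; rewrite /= in_itv /= => /andP[t0 t1] <-.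
  exists (1 - t); first by rewrite /= in_itv /= subr_ge0 t1 gerBl t0.
  by apply/rowP => i; rewrite !mxE; ring.
exact: nb sw bw.
Qed.

Lemma capN_strip (R : realType) N (Om : set 'rV[R]_N) x n eps r :
  (forall z, boundary Om z -> eball x r z -> `|dotv n (z - x)| <= eps * r) ->
  forall z, boundary Om z -> eball x r z -> `|dotv (- n) (z - x)| <= eps * r.
Proof. by move=> h z bz xz; rewrite dotvNl normrN; exact: h. Qed.

(* The sign of [n] can be chosen so that [0 <= dotv n m].  The witness lies on
   the bisector of [n] and [m], at height 7r/10 above both hyperplanes: within
   the ball because (7/10)^2 < 1/2, and beyond [eps * s] because
   7/10 > (1/2)(4/3). *)
Lemma cap_overlap (R : realType) N (eps r s : R) (x n m : 'rV[R]_N) :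
  0 < eps -> eps < 1 / 2 -> 0 < r -> r <= s -> s <= 4 / 3 * r ->
  dotv n n = 1 -> dotv m m = 1 -> 0 <= dotv n m ->
  exists2 y, cap x n eps r y & cap x m eps s y.
Proof.
move=> e0 e1 r0 rs sr n1 m1 nm.
set c := dotv n m in nm *.
have c1 : 0 < 1 + c by lra.
pose t := 7 / 10 * r / (1 + c).
have tc : t * (1 + c) = 7 / 10 * r by rewrite /t divfK// gt_eqF.
have t0 : 0 < t by rewrite /t divr_gt0// mulr_gt0// divr_gt0.
have tr : t <= 7 / 10 * r by nra.
have yx : x + t *: (n + m) - x = t *: (n + m) by rewrite addrC addKr.
have nr : enorm (t *: (n + m)) < r.
  rewrite enorm_lt//; have -> : dotv (t *: (n + m)) (t *: (n + m)) =
    2 * (t * (t * (1 + c))) by rewrite !dotvE (dotvC m n) n1 m1 -/c; ring.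
  by rewrite tc; nra.
exists (x + t *: (n + m)); split; rewrite yx ?(lt_le_trans nr)//.
  by rewrite dotvZr dotvDr n1 -/c tc; nra.
by rewrite dotvZr dotvDr (dotvC m n) m1 -/c [c + 1]addrC tc; nra.
Qed.

(** The normal is oriented towards [Om]. The plane itself is left out: the induction on scales
    carries only the two caps. *)
Definition separates (R : realType) N (eps : R) (Om : set 'rV[R]_N) x r n :=
  [/\ dotv n n = 1, cap x n eps r `<=` Om & cap x (- n) eps r `<=` ~` Om].

Lemma separates_downscale (R : realType) N (eps r s : R) (Om : set 'rV[R]_N)
    x n m :
  open Om -> 0 < eps -> eps < 1 / 2 -> 0 < r -> r <= s -> s <= 4 / 3 * r ->
  dotv n n = 1 ->
  (forall z, boundary Om z -> eball x r z -> `|dotv n (z - x)| <= eps * r) ->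
  separates eps Om x s m -> exists k, separates eps Om x r k.
Proof.
move=> oOm e0 e1 r0 rs sr n1 strip [m1 mO mnO].
(* The strip is symmetric under [n -> - n], and the conclusion does not mention [n]. *)
wlog nm : n n1 strip / 0 <= dotv n m.
  move=> w; have [nm|nm] := leP 0 (dotv n m); first exact: (w n).
  apply: (w (- n)); rewrite ?dotvE ?opprK//; first exact: capN_strip.
  by rewrite oppr_ge0 ltW.
exists n; split=> //.
  have [y yn /mO Oy] := cap_overlap x e0 e1 r0 rs sr n1 m1 nm.
  exact: (cap_homogeneous oOm strip yn).1.
have [||| y yn /mnO Oy] := @cap_overlap R N _ _ _ x (- n) (- m) e0 e1 r0 rs sr.
- by rewrite !dotvE opprK.
- by rewrite !dotvE opprK.
- by rewrite !dotvE opprK.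
exact: (cap_homogeneous oOm (capN_strip strip) yn).2.
Qed.

Lemma connected_component_segment (R : realType) N (A : set 'rV[R]_N) y z :
  segment y z `<=` A -> connected_component A y = connected_component A z.
Proof.
move=> sA; apply: same_connected_component.
by apply: (connected_component_max (segment_start y z) sA);
  [exact: connected_segment | exact: segment_end].
Qed.

(** Every point of the set is joined inside it by a segment to [x + t n] or [x - t n], so [C1] and
    [C2] are the components of these two points, which also lie in the two caps. *)
Lemma separates_top_scale (R : realType) N (eps r : R) (Om : set 'rV[R]_N)
    (C1 C2 : set 'rV[R]_N) x n :
  open Om -> 0 < eps -> eps < 1 / 2 -> 0 < r -> dotv n n = 1 ->
  (forall z, boundary Om z -> eball x r z -> `|dotv n (z - x)| <= eps * r) ->
  C1 <> C2 ->
  components (eball x r `&` [set y | 2 * eps * r <= `|dotv n (y - x)|])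
    = [set C1; C2] ->
  C1 `<=` Om -> C2 `<=` ~` Om -> exists k, separates eps Om x r k.
Proof.
move=> oOm e0 e1 r0 n1 strip C12.
set E := _ `&` _ => defC C1O C2O.
(* Midpoint of the heights [2 * eps * r] and [r]. *)
pose t := (1 + 2 * eps) / 2 * r.
have tr : t < r by rewrite /t; nra.
have t2 : 2 * eps * r < t by rewrite /t; nra.
have et : eps * r < t by nra.
have t0 : 0 < t by nra.
have side m y : dotv m m = 1 -> (m = n \/ m = - n) -> E y ->
    0 <= dotv m (y - x) ->
    connected_component E y = connected_component E (x + t *: m).
  move=> m1 mn [yr hy] m0; apply: connected_component_segment => w sw; split.
    apply: segment_eball sw => //; rewrite /eball /= addrC addKr enormZ.
    by rewrite [enorm m]/enorm m1 sqrtr1 mulr1 gtr0_norm.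
  have nm u : `|dotv n u| = `|dotv m u|.
    by case: mn => ->; rewrite // dotvNl normrN.
  rewrite /= nm; apply: le_trans (ler_norm _).
  apply: segment_closed_halfspace sw.
    by move: hy; rewrite /= nm ger0_norm.
  by rewrite addrC addKr dotvZr m1; lra.
have ptE m : dotv m m = 1 -> (m = n \/ m = - n) -> E (x + t *: m).
  move=> m1 mn; split.
    rewrite /eball /= addrC addKr enormZ.
    by rewrite [enorm m]/enorm m1 sqrtr1 mulr1 gtr0_norm.
  rewrite /= addrC addKr.
  have -> : `|dotv n (t *: m)| = t; last exact: ltW.
  by case: mn => ->; rewrite !dotvE n1 ?mulrN ?normrN mulr1 gtr0_norm.
have capp m : dotv m m = 1 -> cap x m eps r (x + t *: m).
  move=> m1; rewrite /cap /= addrC addKr enormZ dotvZr m1.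
  by rewrite [enorm m]/enorm m1 sqrtr1 mulr1 gtr0_norm; lra.
have nN1 : dotv (- n) (- n) = 1 by rewrite !dotvE opprK.
pose D1 := connected_component E (x + t *: n).
pose D2 := connected_component E (x + t *: - n).
have allD C : [set C1; C2] C -> C = D1 \/ C = D2.
  rewrite -defC => -[y Ey <-].
  have [h|h] := leP 0 (dotv n (y - x)); [left|right]; apply: side => //.
  - by left.
  - by right.
  - by rewrite dotvNl oppr_ge0 ltW.
have D1x : D1 (x + t *: n).
  by apply: connected_component_refl; apply: ptE => //; left.
have D2x : D2 (x + t *: - n).
  by apply: connected_component_refl; apply: ptE => //; right.
(* As [C1] and [C2] differ, they are [D1] and [D2] in one of the two orders; the order decides the
   sign of the normal. *)
have := allD C2 (or_intror erefl); have := allD C1 (or_introl erefl).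
move=> [e1'|e1'] [e2'|e2'].
- by case: C12; rewrite e1' e2'.
- exists n; split=> //.
    apply: (cap_homogeneous oOm strip (capp _ n1)).1.
    by apply: C1O; rewrite e1'.
  apply: (cap_homogeneous oOm (capN_strip strip) (capp _ nN1)).2.
  by apply: C2O; rewrite e2'.
- exists (- n); split=> //.
    apply: (cap_homogeneous oOm (capN_strip strip) (capp _ nN1)).1.
    by apply: C1O; rewrite e1'.
  rewrite opprK; apply: (cap_homogeneous oOm strip (capp _ n1)).2.
  by apply: C2O; rewrite e2'.
- by case: C12; rewrite e1' e2'.
Qed.

Lemma reifenberg_separates (R : realType) N (eps r0 : R) (Om : set 'rV[R]_N)
    x r :
  0 < eps -> eps < 1 / 2 -> reifenberg_flat eps r0 Om -> boundary Om x ->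
  0 < r -> r <= r0 -> exists n, separates eps Om x r n.
Proof.
move=> e0 e1 [_ oOm [P [flat top]]] bx r_gt0 rr0.
have strips s : 0 < s -> s <= r0 -> exists n,
    [/\ dotv n n = 1, P x s = [set y | dotv n (y - x) = 0] &
     forall z, boundary Om z -> eball x s z -> `|dotv n (z - x)| <= eps * s].
  move=> s0 sr0; have [hP Px hd] := flat x s bx s0 sr0.
  have [n [n1 defP hn]] := flat_strip s0 hP Px hd.
  by exists n; split => // z bz xz; apply: hn.
have r00 : 0 < r0 by exact: lt_le_trans rr0.
have base : exists n, separates eps Om x r0 n.
  have [n [n1 defP hn]] := strips r0 r00 (lexx _).
  have [C1 [C2 [C12 defC C1O C2O]]] := top x bx.
  apply: (separates_top_scale oOm e0 e1 r00 n1 hn C12 _ C1O C2O).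
  rewrite -defC; congr (components (_ `&` _)); apply/seteqP; split=> y /=;
    by rewrite defP dist_hyperplane// lee_fin.
(* The exponent is a multiple of 3 because [(4/3)^3 >= 2], and powers of 2 exceed [r0 / r]. *)
have [k hk] : exists k, r0 <= (4 / 3) ^+ k * r.
  exists (3 * Num.bound (r0 / r))%N; rewrite -ler_pdivrMr// exprM.
  apply: ltW; apply: lt_le_trans (upper_nthrootP (leqnn _)) _.
  by apply: lerXn2r; rewrite ?nnegrE//; lra.
elim: k r r_gt0 rr0 hk => [|k IH] r r_gt0 rr0 hk.
  by have <- : r0 = r by apply/le_anti; rewrite rr0 andbT; rewrite mul1r in hk.
(* If [4/3 r] reaches [r0], the larger scale is [r0] itself, since flatness stops there. *)
have [h|h] := leP r0 (4 / 3 * r).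
  have [n [n1 _ hn]] := strips r r_gt0 rr0; have [m hm] := base.
  exact: (separates_downscale oOm e0 e1 r_gt0 rr0 h n1 hn hm).
have [||m hm] := IH (4 / 3 * r) _ (ltW h); first by rewrite mulr_gt0// divr_gt0.
  by rewrite mulrA -exprSr.
have [n [n1 _ hn]] := strips r r_gt0 rr0.
apply: (separates_downscale oOm e0 e1 r_gt0 _ (lexx _) n1 hn hm).
by rewrite ler_peMl ?ltW//; lra.
Qed.

(** * Outer measure: scaling and the volume of the unit ball *)

Lemma le_leb (R : realType) N (A B : set 'rV[R]_N) :
  A `<=` B -> (leb A <= leb B)%E.
Proof.
move=> AB; apply: ereal_inf_le_tmp => _ [a [b [ab cov ->]]].
by exists a, b; split=> //; exact: subset_trans cov.
Qed.

(** The map [y -> (y - z) / r] turns a cover of the ball into a cover of the unit ball, dividing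
    volumes by [r ^+ N]. *)
Lemma leb_eball (R : realType) N (z : 'rV[R]_N) (r : R) : 0 < r ->
  ((r ^+ N)%:E * omega R N <= leb (eball z r))%E.
Proof.
move=> r0; apply/ereal_infP => _ [a [b [ab cov ->]]].
have rN : 0 < r ^+ N by exact: exprn_gt0.
rewrite -lee_pdivlMl// -nneseriesZl; last first.
  move=> k _.
  by rewrite lee_fin; apply: prodr_ge0 => i _; rewrite subr_ge0.
apply: ereal_inf_lbound.
exists (fun k => r^-1 *: (a k - z)), (fun k => r^-1 *: (b k - z)); split.
- by move=> k i; rewrite !mxE ler_pM2l ?invr_gt0// lerD2r.
- move=> y y1; have : eball z r (z + r *: y).
    move: y1; rewrite /eball /= subr0 addrC addKr /enorm => y1.
    have -> : dotv (r *: y) (r *: y) = r ^+ 2 * dotv y y.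
      by rewrite mulr_sumr; apply: eq_bigr => i _; rewrite !mxE; ring.
    by rewrite sqrtrM ?sqr_ge0// sqrtr_sqr gtr0_norm// gtr_pMr.
  move=> /cov[k _ hk]; exists k => // i; have := hk i; rewrite !mxE.
  by rewrite ler_pdivrMl// ler_pdivlMl// lerBlDl lerBrDl.
- apply: eq_eseriesr => k _; rewrite -EFinM; congr EFin.
  rewrite -exprVn -[in X in X * _](card_ord N) -prodr_const -big_split /=.
  by apply: eq_bigr => i _; rewrite !mxE; ring.
Qed.

(* A fractional cover of a box by boxes, where the k-th box counts with weight
   [w k]: slicing along the last coordinate multiplies the weights by
   indicators, so the induction on the dimension only needs the integral on the
   line. *)
Lemma box_weighted_cover (R : realType) (N : nat) (w : nat -> R)
    (a b : nat -> R) (c d : nat -> nat -> R) :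
  (forall k, 0 <= w k) -> (forall i, a i <= b i) ->
  (forall k i, c k i <= d k i) ->
  (forall x : nat -> R, (forall i, (i < N)%N -> a i <= x i <= b i) ->
    (1 <= \sum_(0 <= k <oo)
      (w k * \prod_(i < N) (c k i <= x i <= d k i)%R%:R)%:E)%E) ->
  ((\prod_(i < N) (b i - a i))%:E <=
   \sum_(0 <= k <oo) (w k * \prod_(i < N) (d k i - c k i))%:E)%E.
Proof.
move=> + ab cd; elim: N w => [|N IH] w w0 cov.
  have := cov (fun=> 0); rewrite !big_ord0 => /(_ _)/le_trans; apply => //.
  by apply: lee_nneseries => k _; rewrite ?lee_fin ?big_ord0 ?mulr1.
pose V k := \prod_(i < N) (d k i - c k i).
have V0 k : 0 <= V k by apply: prodr_ge0 => i _; rewrite subr_ge0.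
pose f k (t : R) := ((w k * V k)%:E * (\1_(`[c k N, d k N] : set R) t)%:E)%E.
have f0 k t : (0 <= f k t)%E by rewrite mule_ge0 ?lee_fin ?mulr_ge0.
have mf k D : measurable_fun D (f k).
  apply: emeasurable_funM; first exact: measurable_cst.
  by apply/measurable_EFinP; exact: measurable_indic.
have slice t : `[a N, b N]%classic t ->
    ((\prod_(i < N) (b i - a i))%:E <= \sum_(0 <= k <oo) f k t)%E.
  rewrite /= in_itv /= => tab.
  have -> : (\sum_(0 <= k <oo) f k t = \sum_(0 <= k <oo)
     ((w k * (c k N <= t <= d k N)%R%:R) * V k)%:E)%E.
    apply: eq_eseriesr => k _.
    by rewrite /f indicE mem_setE in_itv /= -EFinM mulrAC.
  apply: IH => [k|x xab]; first by rewrite mulr_ge0.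
  pose y i := if i == N then t else x i.
  have yN : y N = t by rewrite /y eqxx.
  have yi (i : 'I_N) : y i = x i by rewrite /y ltn_eqF.
  have <- : (\sum_(0 <= k <oo)
      (w k * \prod_(i < N.+1) (c k i <= y i <= d k i)%R%:R)%:E =
    \sum_(0 <= k <oo) (w k * (c k N <= t <= d k N)%R%:R *
      \prod_(i < N) (c k i <= x i <= d k i)%R%:R)%:E)%E.
    apply: eq_eseriesr => k _; rewrite big_ord_recr /= yN.
    under eq_bigr do rewrite yi.
    by rewrite -mulrA [_%:R * _]mulrC.
  apply: cov => i; rewrite ltnS leq_eqVlt /y; case: eqVneq => [->|_] //=.
  exact: xab.
have muI u v : u <= v ->
    lebesgue_measure (`[u, v]%classic : set R) = (v - u)%:E.
  move=> uv; apply: etrans (lebesgue_measure_itv `[u, v]) _.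
  rewrite /= lte_fin; move: uv; rewrite le_eqVlt => /predU1P[->|->]//.
  by rewrite ltxx subrr.
have <- : (\int[lebesgue_measure]_(t in `[a N, b N])
    (\prod_(i < N) (b i - a i))%:E = (\prod_(i < N.+1) (b i - a i))%:E)%E.
  apply: etrans (integral_cst _ _ _) _ => //.
  by rewrite big_ord_recr /= EFinM muI.
(* Integrate the slice bound over [[a N, b N]] and exchange sum and integral; the k-th integral is
   [w k * V k] times the length of an intersection, at most [d k N - c k N]. *)
apply: (@le_trans _ _ (\sum_(0 <= k <oo)
  \int[lebesgue_measure]_(t in `[a N, b N]) f k t)%E); last first.
  apply: lee_nneseries => [k _ _|k _]; first exact: integral_ge0.
  rewrite ge0_integralZl_EFin ?mulr_ge0//; last first.
    by apply/measurable_EFinP; exact: measurable_indic.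
  rewrite integral_indic// big_ord_recr /= -/(V k) mulrA (EFinM (w k * V k)).
  apply: lee_wpmul2l; first by rewrite lee_fin mulr_ge0.
  rewrite -muI//.
  apply: le_measure; rewrite ?inE.
  - exact: measurableI.
  - by [].
  - exact: subIsetl.
have <- : (\int[lebesgue_measure]_(t in `[a N, b N])
    \sum_(0 <= k <oo) f k t = \sum_(0 <= k <oo)
    \int[lebesgue_measure]_(t in `[a N, b N]) f k t)%E.
  by apply: integral_nneseries => // n; exact: mf.
apply: (@ge0_le_integral _ _ _ lebesgue_measure `[a N, b N]%classic _
  (fun=> (\prod_(i < N) (b i - a i))%:E) (fun t => \sum_(0 <= k <oo) f k t)%E).
- by [].
- by move=> t _; rewrite lee_fin prodr_ge0// => i _; rewrite subr_ge0.
- exact: measurable_cst.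
- by apply: ge0_emeasurable_sum => // k _; exact: mf.
- exact: slice.
Qed.

Lemma omega_gt0 (R : realType) N : (0 < omega R N)%E.
Proof.
(* The cube of half-side [c] lies in the unit ball because [N c^2 < 1]; the cover inequality is
   applied to it with unit weights. *)
pose c : R := (N.+1%:R)^-1.
have c0 : 0 < c by rewrite invr_gt0.
suff h : ((\prod_(i < N) (c - (- c)))%:E <= omega R N)%E.
  by apply: lt_le_trans h; rewrite lte_fin prodr_gt0// => i _; lra.
apply/ereal_infP => _ [a [b [ab cov ->]]].
pose ext (u : 'rV[R]_N) i := if insub i is Some j then u 0 j else 0.
have extE u (i : 'I_N) : ext u i = u 0 i by rewrite /ext valK.
have -> : (\sum_(0 <= k <oo) (\prod_(i < N) (b k 0 i - a k 0 i))%:E =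
    \sum_(0 <= k <oo)
      (1 * \prod_(i < N) (ext (b k) i - ext (a k) i))%:E)%E.
  apply: eq_eseriesr => k _; rewrite mul1r; congr EFin.
  by apply: eq_bigr => i _; rewrite !extE.
apply: (@box_weighted_cover R N (fun=> 1) (fun=> - c) (fun=> c)
  (fun k => ext (a k)) (fun k => ext (b k))) => //.
- by move=> i; lra.
- by move=> k i; rewrite /ext; case: insub.
move=> x xc; pose y : 'rV[R]_N := \row_i x i.
have : eball 0 1 y.
  rewrite /eball /= subr0 /enorm -sqrtr1 ltr_sqrt//.
  apply: (@le_lt_trans _ _ (\sum_(i < N) c ^+ 2)).
    apply: ler_sum => i _; rewrite mxE.
    have /andP[h1 h2] := xc i (ltn_ord i); nra.
  rewrite sumr_const card_ord -mulr_natr.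
  have e : c * N.+1%:R = 1 by rewrite mulVf.
  have h : c * N%:R < 1 by rewrite -[ltRHS]e ltr_pM2l// ltr_nat.
  have c1 : c <= 1 by rewrite invf_le1// ler1n.
  have : 0 <= c * N%:R by rewrite mulr_ge0// ltW.
  nra.
move=> /cov[k _ hk].
apply: le_trans (_ : (1 * \prod_(i < N)
    (ext (a k) i <= x i <= ext (b k) i)%R%:R)%:E <= _)%E.
  rewrite mul1r lee_fin big1// => i _; have := hk i; rewrite !extE mxE => ->.
  by [].
(* The box containing the point already contributes 1. *)
rewrite (nneseriesD1 (n := k))// => [|j _]; last first.
  by rewrite lee_fin mul1r prodr_ge0.
rewrite leeDl// nneseries_ge0// => j _ _.
by rewrite lee_fin mul1r prodr_ge0.
Qed.

(** One cube [[-1, 1]^N] covers the ball; the other boxes are reduced to the origin and have volume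
    0 since [N] is positive. *)
Lemma omega_lty (R : realType) N : (0 < N)%N -> (omega R N < +oo)%E.
Proof.
move=> N0.
pose b k : 'rV[R]_N := if k is 0%N then const_mx 1 else 0.
apply: (@le_lt_trans _ _ (\sum_(0 <= k <oo)
   (\prod_(i < N) (b k 0 i - (- b k) 0 i))%:E)%E).
  apply: ereal_inf_lbound; exists (fun k => - b k), b; split => //.
    by move=> [|k] i; rewrite /b !mxE//; lra.
  move=> y; rewrite /eball /= subr0 => y1; exists 0%N => // i; rewrite !mxE.
  rewrite -ler_norml; apply: le_trans (ltW y1).
  rewrite -sqrtr_sqr /enorm ler_wsqrtr// /dotv (bigD1 i)//= -expr2 lerDl.
  by apply: sumr_ge0 => j _; rewrite -expr2 sqr_ge0.
have pr k : 0 <= \prod_(i < N) (b k 0 i - (- b k) 0 i).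
  by apply: prodr_ge0 => i _; case: k => [|k]; rewrite /b !mxE; lra.
rewrite (nneseriesD1 (n := 0%N)) => [|k _|]; [ |by rewrite lee_fin|by []].
rewrite [X in (_ + X)%E](_ : _ = 0%E); first by rewrite adde0 ltry.
apply: eseries0 => -[|k] // _ _.
by rewrite (bigD1 (Ordinal N0))//= !mxE !oppr0 addr0 mul0r.
Qed.

Lemma le_radius_leb (R : realType) N (A : set 'rV[R]_N) z r :
  (0 < N)%N -> 0 < r -> eball z r `<=` A ->
  (r%:E <= poweR (leb A / omega R N) N%:R^-1)%E.
Proof.
move=> N0 r0 zA.
have := le_trans (leb_eball z r0) (le_leb zA).
have := omega_gt0 R N; have := omega_lty R N0.
case: (omega R N) => // w _; rewrite lte_fin => w0 rw.
have {}rw : ((r ^+ N)%:E <= leb A / w%:E)%E.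
  by rewrite inver gt_eqF// lee_pdivlMr.
have -> : r%:E = poweR (r ^+ N)%:E N%:R^-1.
  rewrite poweR_EFin -powR_mulrn ?ltW// -powRrM mulfV ?powRr1 ?ltW//.
  by rewrite pnatr_eq0 -lt0n.
have rN : (0 <= (r ^+ N)%:E)%E by rewrite lee_fin exprn_ge0// ltW.
have Aw := le_trans rN rw.
by apply: gt0_ler_poweR rw; rewrite // in_itv /= leey andbT.
Qed.

(** * Interior balls and comparison of volumes *)

Lemma cap_inner_ball (R : realType) N (eps r : R) (x n : 'rV[R]_N) :
  0 < eps -> 0 < r -> dotv n n = 1 ->
  eball (x + ((1 + 2 * eps) / 2 * r) *: n) ((1 - 2 * eps) / 2 * r)
    `<=` cap x n eps r.
Proof.
move=> e0 r0 n1 y; set t := (1 + 2 * eps) / 2 * r.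
have t0 : 0 <= t by rewrite /t; nra.
rewrite /eball /cap /= => yr.
have -> : y - x = t *: n + (y - (x + t *: n)).
  by apply/rowP => i; rewrite !mxE; ring.
move: (y - _) yr => u ur; split.
  apply: le_lt_trans (enormD _ _) _.
  rewrite enormZ [enorm n]/enorm n1 sqrtr1 mulr1 ger0_norm//.
  by move: ur; rewrite /t; lra.
have := dotv_unit_le u n1; rewrite dotvDr dotvZr n1 ler_norml => /andP[un _].
by move: ur un; rewrite /t; nra.
Qed.

Lemma reifenberg_ball (R : realType) N (eps r0 d : R) (Om A : set 'rV[R]_N) x :
  0 < eps -> eps < 1 / 2 -> reifenberg_flat eps r0 Om ->
  A = Om \/ A = ~` Om -> A x -> 0 < d -> d <= 4 * r0 ->
  exists z, eball z ((1 - 2 * eps) / 8 * d) `<=` A `&` eball x d.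
Proof.
move=> e0 e1 hOm hA Ax d0 dr.
have oOm : open Om by case: hOm.
have d4 : 0 < d / 4 by rewrite divr_gt0.
have xx : eball x (d / 2) x by rewrite /eball /= subrr enorm0 divr_gt0.
have [[w bw xw]|nb] := pselect (exists2 w, boundary Om w & eball x (d / 2) w).
  have [|n [n1 nO nOc]] := reifenberg_separates e0 e1 hOm bw d4; first by lra.
  have capx m : cap w m eps (d / 4) `<=` eball x d.
    move=> y [yw _]; rewrite /eball /=.
    apply: le_lt_trans (enorm_dist _ w _) _.
    by move: xw; rewrite /eball /=; lra.
  have rE : (1 - 2 * eps) / 8 * d = (1 - 2 * eps) / 2 * (d / 4) by field.
  have [m m1 mA] : exists2 m, dotv m m = 1 & cap w m eps (d / 4) `<=` A.
    by case: hA => ->; [exists n | exists (- n)] => //; rewrite !dotvE opprK.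
  exists (w + ((1 + 2 * eps) / 2 * (d / 4)) *: m); rewrite rE => y.
  move/(cap_inner_ball e0 d4 m1) => cy.
  by split; [exact: (mA y cy) | exact: (capx m y cy)].
exists x => y yx.
have {}yx : eball x (d / 2) y.
  by apply: lt_le_trans yx _; nra.
split; last by apply: lt_trans yx _; lra.
apply: contrapT => nAy; apply: nb.
case: hA Ax nAy => -> /= Ax nAy.
  exact: (boundary_near oOm xx yx Ax nAy).
exact: (boundary_near oOm yx xx (contrapT nAy) Ax).
Qed.

Lemma excess_le_leb (R : realType) N (eps r0 : R) (Om A B S : set 'rV[R]_N) :
  (0 < N)%N -> 0 < eps -> eps < 1 / 2 -> reifenberg_flat eps r0 Om ->
  A = Om \/ A = ~` Om -> A `\` B `<=` S ->
  (excess A B <= (4 * r0)%:E)%E ->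
  (excess A B <= (8 / (1 - 2 * eps))%:E *
     poweR (leb S / omega R N) N%:R^-1)%E.
Proof.
move=> N0 e0 e1 hOm hA ABS hd.
have k0 : 0 < 8 / (1 - 2 * eps) by rewrite divr_gt0//; lra.
have rhs0 : (0 <= (8 / (1 - 2 * eps))%:E *
     poweR (leb S / omega R N) N%:R^-1)%E.
  by rewrite mule_ge0 ?poweR_ge0// lee_fin ltW.
apply/ereal_supP => _ [->//|[x Ax <-]].
have : (dist_set x B <= (4 * r0)%:E)%E.
  by apply: le_trans hd; apply: ereal_sup_ubound; right; exists x.
have dist0 : (0 <= dist_set x B)%E.
  by apply/dist_set_ge => a _; exact: enorm_ge0.
case E : (dist_set x B) dist0 => [d| |] //.
rewrite !lee_fin le_eqVlt => /predU1P[<-//|d0] dr.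
have [z zA] := reifenberg_ball e0 e1 hOm hA Ax d0 dr.
have := @le_radius_leb _ _ S z ((1 - 2 * eps) / 8 * d) N0.
have -> : d%:E = ((8 / (1 - 2 * eps))%:E * ((1 - 2 * eps) / 8 * d)%:E)%E.
  by rewrite -EFinM; congr EFin; field; rewrite gt_eqF//; lra.
move=> h; apply: lee_wpmul2l; first by rewrite lee_fin ltW.
apply: h.
  by rewrite mulr_gt0// divr_gt0//; lra.
move=> y /zA[Ay xy]; apply: ABS; split => // By.
have : (d%:E <= dist_set x B)%E by rewrite E.
by move/dist_set_ge/(_ y By); rewrite enormBC leNgt xy.
Qed.

Theorem lemma16 (R : realType) (N : nat) (eps r0 : R) (X Y : set 'rV[R]_N)
  (hN : (0 < N)%N) (heps0 : 0 < eps) (heps : eps < 1 / 2) (hr0 : 0 < r0)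
  (hX : reifenberg_flat eps r0 X) (hY : reifenberg_flat eps r0 Y) :
  ((hausdorff_dist X Y <= (4 * r0)%:E)%E ->
   (hausdorff_dist X Y <=
     (8 / (1 - 2 * eps))%:E *
       poweR (leb (X `+` Y) / omega R N) (N%:R^-1))%E) /\
  ((hausdorff_dist (~` X) (~` Y) <= (4 * r0)%:E)%E ->
   (hausdorff_dist (~` X) (~` Y) <=
     (8 / (1 - 2 * eps))%:E *
       poweR (leb (X `+` Y) / omega R N) (N%:R^-1))%E).
Proof.
split; rewrite /hausdorff_dist !ge_max => /andP[h1 h2]; apply/andP; split.
- by apply: (excess_le_leb hN heps0 heps hX _ _ h1); [left | move=> ?; left].
- by apply: (excess_le_leb hN heps0 heps hY _ _ h2); [left | move=> ?; right].
- apply: (excess_le_leb hN heps0 heps hX _ _ h1); first by right.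
  by move=> y [nX /contrapT Yy]; right.
- apply: (excess_le_leb hN heps0 heps hY _ _ h2); first by right.
  by move=> y [nY /contrapT Xy]; left.
Qed.
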